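(* Let $\phi=\{\phi_t: t\geq 0\}$ be a $CP$-semigroup acting on $\mathcal B(H)$, where $H$ is a separable Hilbert space, and let $\mathcal D$ be the domain of its generator. Then $$\mathcal A=\{A\in\mathcal D: A^*A\in\mathcal D,\ AA^*\in\mathcal D\}$$ is a $*$-subalgebra of $\mathcal B(H)$.
   Context: $H$ is a separable complex Hilbert space. A $CP$-semigroup on $\mathcal B(H)$ is a family $\phi=\{\phi_t: t\ge 0\}$ of normal completely positive linear maps $\phi_t:\mathcal B(H)\to\mathcal B(H)$ with $\phi_0=\mathrm{id}$, $\phi_s\circ\phi_t=\phi_{s+t}$, $\phi_t(\mathbf 1)=\mathbf 1$ for all $t$, and such that $t\mapsto\langle\phi_t(A)\xi,\eta\rangle$ is continuous on $[0,\infty)$ for all $A\in\mathcal B(H)$, $\xi,\eta\in H$. The domain $\mathcal D$ of the generator is the set of all $A\in\mathcal B(H)$ for which the limit $L(A)=\lim_{t\to0+}\frac1t(\phi_t(A)-A)$ exists in the strong-$*$ topology of $\mathcal B(H)$ (equivalently, in the weak operator topology; equivalently, $\sup_{t>0}\frac1t\|\phi_t(A)-A\|<\infty$; equivalently, $\sup_n\frac1{t_n}\|\phi_{t_n}(A)-A\|<\infty$ for some sequence $t_n\to0+$). The map $L:\mathcal D\to\mathcal B(H)$ is the generator. *)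

(* Defs.v *)
From HB Require Import structures.
From mathcomp Require Import all_boot all_order all_algebra.
From mathcomp Require Import all_classical all_reals all_analysis.
From mathcomp Require Import complex.

Set Implicit Arguments.
Unset Strict Implicit.
Unset Printing Implicit Defensive.

Import Order.TTheory GRing.Theory Num.Theory.
Import numFieldNormedType.Exports.

Local Open Scope classical_set_scope.
Local Open Scope complex_scope.
Local Open Scope ring_scope.

(* [numFieldNormedType] only equips abstract fields with their topology; this
   gives the concrete type [R[i]] the same normed-module structure. *)
HB.instance Definition _ (R : realType) := NormedModule.copy R[i] (R[i]^o).

(* The inner product is linear in its first argument. *)
HB.mixin Record CompleteNormedModule_isHilbert (R : realType) H
    of CompleteNormedModule R[i] H := {
  hdot : {dot H for (@Num.conj R[i])};
  hdot_norm : forall x : H, hdot x x = `|x| ^+ 2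
}.

#[short(type="hilbertType")]
HB.structure Definition Hilbert (R : realType) :=
  {H of CompleteNormedModule R[i] H & CompleteNormedModule_isHilbert R H}.

Notation "''[' x , y ]" := (hdot x%R y%R) : ring_scope.

Definition separable (T : topologicalType) : Prop :=
  exists2 D : set T, countable D & dense D.

Section BoundedOperators.
Context {R : realType} {H : hilbertType R}.

Definition bounded_op : {pred H -> H} :=
  mem [set f : H -> H | linear f /\ continuous f].

Lemma bounded_opP (f : H -> H) :
  reflect (linear f /\ continuous f) (f \in bounded_op).
Proof. by apply: (iffP idP) => [/set_mem|/mem_set]. Qed.

Lemma bounded_op_submod : submod_closed bounded_op.
Proof.
split=> [|a f g /bounded_opP[lf cf] /bounded_opP[lg cg]]; apply/bounded_opP.
  by split=> [a x y|x]; [rewrite /= scaler0 addr0|exact: cvg_cst].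
split=> [b x y|x].
  have fgE z : (a *: f + g) z = a *: f z + g z by [].
  by rewrite !fgE lf lg !scalerDr !scalerA (mulrC a b) addrACA.
by apply: (@cvgD _ _ _ _ _ (a \*: f) g); [exact: cvgZl_tmp (cf x)|exact: cg].
Qed.

HB.instance Definition _ :=
  GRing.isSubmodClosed.Build R[i] (H -> H) bounded_op bounded_op_submod.

Record bop := Bop { bop_fun :> H -> H; _ : bop_fun \in bounded_op }.

HB.instance Definition _ := [isSub for bop_fun].
HB.instance Definition _ := [Choice of bop by <:].
HB.instance Definition _ := [SubChoice_isSubLmodule of bop by <:].

Lemma bop_linear (A : bop) : linear A.
Proof. by have /bounded_opP[] := valP A. Qed.

Lemma bop_continuous (A : bop) : continuous A.
Proof. by have /bounded_opP[] := valP A. Qed.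

Lemma bopP (A B : bop) : A = B <-> forall x, A x = B x.
Proof. by split=> [->//|AB]; apply/val_inj/funext. Qed.

Fact bop_one_subproof : (id : H -> H) \in bounded_op.
Proof. by apply/bounded_opP; split=> // x; exact: cvg_id. Qed.

Fact bop_mul_subproof (A B : bop) : A \o B \in bounded_op.
Proof.
apply/bounded_opP; split=> [a x y|x]; first by rewrite /= !bop_linear.
by apply: continuous_comp; exact: bop_continuous.
Qed.

Definition bop_one : bop := Bop bop_one_subproof.
Definition bop_mul (A B : bop) : bop := Bop (bop_mul_subproof A B).

Lemma bop_addE (A B : bop) x : (A + B) x = A x + B x.
Proof. by []. Qed.

Lemma bop_scaleE a (A : bop) x : (a *: A) x = a *: A x.
Proof. by []. Qed.

Fact bop_mulA : associative bop_mul. Proof. by move=> A B C; apply/bopP. Qed.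
Fact bop_mul1l : left_id bop_one bop_mul. Proof. by move=> A; apply/bopP. Qed.
Fact bop_mul1r : right_id bop_one bop_mul. Proof. by move=> A; apply/bopP. Qed.
Fact bop_mulDl : left_distributive bop_mul +%R.
Proof. by move=> A B C; apply/bopP. Qed.
Fact bop_mulDr : right_distributive bop_mul +%R.
Proof.
move=> A B C; apply/bopP => x.
rewrite -[LHS]/(A (B x + C x)) -[RHS]/(A (B x) + A (C x)).
by rewrite -{1}[B x]scale1r bop_linear scale1r.
Qed.

(* Only [pzRingType]: [H] may be trivial, in which case [1 = 0]. *)
HB.instance Definition _ := GRing.Zmodule_isPzRing.Build bop
  bop_mulA bop_mul1l bop_mul1r bop_mulDl bop_mulDr.

(* By the Riesz representation theorem such a [B] exists, and it is unique, so
   the default value of [xget] is irrelevant. *)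
Definition adj (A : bop) : bop :=
  xget 0 [set B : bop | forall x y, '[A x, y] = '[x, B y]].

Definition strong_star_cvg (F : set_system bop) (A : bop) : Prop :=
  (forall x : H, (fun X : bop => X x) @ F --> A x) /\
  (forall x : H, (fun X : bop => adj X x) @ F --> adj A x).

Definition square_summable (u : nat -> H) : Prop :=
  cvgn (series (fun n => `|u n| ^+ 2)).

Definition normal_form (u v : nat -> H) (A : bop) : R[i] :=
  limn (series (fun n => '[A (u n), v n])).

(* Convergence in the ultraweak (sigma-weak) topology, the initial topology of
   the functionals [normal_form u v] with [u] and [v] square-summable. *)
Definition ultraweak_cvg (F : set_system bop) (A : bop) : Prop :=
  forall u v : nat -> H, square_summable u -> square_summable v ->
    normal_form u v @ F --> normal_form u v A.

(* Continuity for the ultraweak topology on both sides. *)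
Definition normal_map (phi : bop -> bop) : Prop :=
  forall (F : set_system bop) (A : bop), ProperFilter F ->
    ultraweak_cvg F A -> ultraweak_cvg (phi @ F) (phi A).

(* An [n] x [n] matrix of operators as a positive operator on [H ^ n]. *)
Definition positive_opmx n (A : 'M[bop]_n) : Prop :=
  forall x : 'I_n -> H, 0 <= \sum_i \sum_j '[A i j (x j), x i].

Definition completely_positive (phi : bop -> bop) : Prop :=
  forall n (A : 'M[bop]_n), positive_opmx A -> positive_opmx (map_mx phi A).

(* Only the values [phi t] with [0 <= t] are meaningful. *)
Record CP_semigroup (phi : R -> bop -> bop) : Prop := {
  CP_semigroup_linear : forall t : R, 0 <= t -> linear (phi t);
  CP_semigroup_cp : forall t : R, 0 <= t -> completely_positive (phi t);
  CP_semigroup_normal : forall t : R, 0 <= t -> normal_map (phi t);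
  CP_semigroup0 : phi 0 = id;
  CP_semigroupD : forall s t : R, 0 <= s -> 0 <= t ->
    phi s \o phi t = phi (s + t);
  CP_semigroup1 : forall t : R, 0 <= t -> phi t 1 = 1;
  CP_semigroup_continuous : forall (A : bop) (x y : H),
    {within `[0, +oo[, continuous (fun t : R => '[phi t A x, y])}
}.

Definition is_generator_value (phi : R -> bop -> bop) (A L : bop) : Prop :=
  strong_star_cvg ((t^-1)%:C *: (phi t A - A) @[t --> 0^'+]) L.

Definition generator_domain (phi : R -> bop -> bop) : set bop :=
  [set A | exists L, is_generator_value phi A L].

Definition domain_algebra (phi : R -> bop -> bop) : set bop :=
  [set A | generator_domain phi A /\
           generator_domain phi (adj A * A) /\
           generator_domain phi (A * adj A)].

(* A subalgebra is not required to contain the unit. *)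
Definition star_subalgebra (S : set bop) : Prop :=
  [/\ GRing.submod_closed [in S], GRing.mulr_2closed [in S] &
      forall A, S A -> S (adj A)].

End BoundedOperators.

Arguments bop {R} H.

(* Main.v *)
Require Import Defs.
From HB Require Import structures.
From mathcomp Require Import all_boot all_order all_algebra.
From mathcomp Require Import all_classical all_reals all_analysis.
From mathcomp Require Import complex ring.

(** Write phi_t for the semigroup.  The proof rests on a description of the
    generator domain that makes no reference to limits: A belongs to it if and
    only if its orbit is Lipschitz at 0, that is, the operator norm of
    phi_t A - A is O(t) as t decreases to 0 ([generator_domainE]).  After that,
    everything is an O(t) estimate.

    The quantity to estimate is the variance
      var_t A = phi_t (adj A * A) - adj (phi_t A) * phi_t A,
    which is a positive operator by the Schwarz inequality.  If the orbit of A
    is Lipschitz, then adj (phi_t A) * phi_t A is within O(t) of adj A * A;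
    hence adj A * A lies in the domain if and only if var_t A = O(t).  So the
    set of the theorem consists of the A such that the orbit of A is Lipschitz
    and both var_t A and var_t (adj A) are O(t) ([domain_algebraE]).

    In a Stinespring dilation phi_t X = adj V * pi(X) * V, with P = V * adj V,
    the form of var_t A at x is the squared norm of (1 - P) pi(A) V x.  This
    vector is linear in A, so the O(t) condition is stable under linear
    combinations ([cp_varD]).  It is also a derivation up to bounded factors:
      (1 - P) pi(AB) V = (1 - P) pi(A) V phi_t(B)
                         + (1 - P) pi(A) (1 - P) pi(B) V,
    so the condition is stable under products ([cp_varM]).  The dilation itself
    is not constructed: each inequality between squared norms of dilated
    vectors is the positivity of a Gram matrix with entries
    phi_t (adj a_i * S * a_j), which is complete positivity ([cp_gram]).
    Finally, if A and B have Lipschitz orbits and variances O(t), then so has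
    each c B + A, hence adj (c B + A) * (c B + A) is in the domain, and
    polarization puts adj A * B there ([lip_orbit_adj_mul]).  Replacing A by
    adj A gives the product A * B.

    The description of the domain is the analytic part.  An operator of the
    domain has a Lipschitz orbit by the uniform boundedness principle
    ([lip_orbit_of_generator_domain]).  Conversely, let the orbit of A be
    Lipschitz.  The difference quotients (phi_t A - A) / t are bounded near 0,
    so they have a weak limit T along an ultrafilter finer than t -> 0+.  On
    bounded families weak convergence is ultraweak, and phi_s is normal, so
    along this ultrafilter t |-> phi_(s+t) A has the weak derivative phi_s T at
    0, for every s ([weak_derivative]).  A function whose increments at each
    point are small along arbitrarily small steps changes little ([dini_le]);
    with the strong continuity of s |-> phi_s T this turns the derivative along
    the ultrafilter into a genuine strong limit ([lip_orbit_derivable]).  The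
    same argument for adj A handles the adjoints. *)

Set Implicit Arguments.
Unset Strict Implicit.
Unset Printing Implicit Defensive.

Import Order.TTheory GRing.Theory Num.Theory.
Import numFieldNormedType.Exports.

Local Open Scope classical_set_scope.
Local Open Scope complex_scope.
Local Open Scope ring_scope.

(** * Real and complex scalars *)

Section Scalars.
Context {R : realType}.

Lemma le_of_eq (a b : R[i]) : a = b -> a <= b.
Proof. by move=> ->. Qed.

Lemma addJ_le (a : R[i]) : a + Num.conj a <= 2 * `|a|.
Proof.
rewrite [leLHS](_ : _ = 2 * 'Re a); last by rewrite ReE mulrC divfK ?pnatr_eq0.
by rewrite ler_pM2l ?ltr0n // (le_trans _ (leif_Re_Creal a)).
Qed.

Lemma prod_le_sum_sqr (a b : R[i]) :
  0 <= a -> 0 <= b -> a * b <= a ^+ 2 + b ^+ 2.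
Proof.
move=> a0 b0; rewrite -subr_ge0.
have h : 0 <= (a - b) ^+ 2.
  by rewrite real_exprn_even_ge0 // rpredB // ger0_real.
by have := addr_ge0 h (mulr_ge0 a0 b0); congr (_ <= _); ring.
Qed.

Lemma ex_inv_succ_lt (e : R[i]) : 0 < e -> exists N : nat, N.+1%:R^-1 < e.
Proof.
move=> e0; have /complex_realP[r er] : e \is Num.real by rewrite gtr0_real.
move: e0; rewrite er ltcR => r0.
have [N _ Nr] := near_infty_natSinv_lt (PosNum r0).
exists N; rewrite -[X in X < _](_ : (N.+1%:R^-1 : R)%:C = _); last first.
  by rewrite fmorphV rmorph_nat.
by rewrite ltcR; apply: (Nr N) => /=.
Qed.

(** Complex numbers above a real number are real, so the infimum can be taken
    in R. *)
Lemma ex_minimizing (T : Type) (t0 : T) (J : T -> R[i]) (b : R[i]) :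
    b \is Num.real -> (forall t, b <= J t) ->
  exists2 m : R[i], (forall t, m <= J t) &
    forall e, 0 < e -> exists t, J t < m + e.
Proof.
move=> /complex_realP[{}b ->] bJ.
have Jr t : J t = (complex.Re (J t))%:C.
  rewrite RRe_real // -(subrK b%:C (J t)) rpredD //.
    by rewrite ger0_real // subr_ge0.
  by apply/complex_realP; exists b.
pose S : set R := range (fun t => complex.Re (J t)).
have infS : has_inf S.
  split; first by exists (complex.Re (J t0)), t0.
  by exists b => _ [t _ <-]; have := bJ t; rewrite Jr lecR.
exists (inf S)%:C => [t|e e0].
  by rewrite Jr lecR; apply: ge_inf; [case: infS|exists t].
have /complex_realP[r er] : e \is Num.real by rewrite gtr0_real.
move: e0; rewrite er ltcR => r0.
have [_ [t _ <-] h] := inf_adherent r0 infS.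
by exists t; rewrite Jr -rmorphD ltcR.
Qed.

Lemma limit_norm_le (V : normedModType R[i]) T (F : set_system T)
    {FF : ProperFilter F} (f : T -> V) l b :
  f @ F --> l -> (\forall t \near F, `|f t| <= b) -> `|l| <= b.
Proof.
move=> fl fb.
have br : b \is Num.real.
  have [t ft] := filter_ex fb; have b0 : 0 <= b := le_trans (normr_ge0 _) ft.
  exact: ger0_real.
rewrite real_leNgt ?normr_real //; apply/negP => bl.
have near_l : \forall t \near F, `|l - f t| < `|l| - b.
  by move/cvgrPdist_lt : fl; apply; rewrite subr_gt0.
have [t [ft lt]] := filter_ex (filterI fb near_l).
have := ler_ltD ft lt; rewrite [ltRHS]addrC subrK => h.
have := le_lt_trans (ler_normD (f t) (l - f t)) h.
by rewrite addrCA subrr addr0 ltxx.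
Qed.

Lemma cvg_real_complex T (F : set_system T) {FF : Filter F}
    (f : T -> R) (l : R) :
  f @ F --> l -> (f t)%:C @[t --> F] --> l%:C.
Proof.
move=> fl; apply/cvgrPdist_le => e e0.
have /complex_realP[r er] : e \is Num.real by rewrite gtr0_real.
move: e0; rewrite er ltcR => r0.
move/cvgrPdist_le : fl => /(_ _ r0); apply: filterS => t.
by rewrite -rmorphB normc_def /= expr0n addr0 sqrtr_sqr lecR.
Qed.

Lemma cvg_complex T (F : set_system T) {FF : Filter F}
    (f : T -> R[i]) (a b : R) :
    complex.Re (f t) @[t --> F] --> a -> complex.Im (f t) @[t --> F] --> b ->
  f @ F --> a +i* b.
Proof.
move=> fa fb.
have -> : f = fun t => (complex.Re (f t))%:C + 'i%C * (complex.Im (f t))%:C.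
  by apply/funext => t; rewrite -complexE.
rewrite [a +i* b](complexE (a +i* b)) /=.
apply: cvgD; first exact: cvg_real_complex.
by apply: cvgM; [exact: cvg_cst|exact: cvg_real_complex].
Qed.

Lemma norm_Re_le (a : R[i]) : `|complex.Re a|%:C <= `|a|.
Proof. exact: normc_ge_Re. Qed.

Lemma norm_Im_le (a : R[i]) : `|complex.Im a|%:C <= `|a|.
Proof.
have -> : complex.Im a = - complex.Re (a * 'i%C) by rewrite ReiNIm opprK.
rewrite normrN (le_trans (norm_Re_le _)) // normrM.
by rewrite [`|'i%C|]normc_def /= expr0n expr1n add0r sqrtr1 mulr1.
Qed.

(** Real and imaginary parts are Lipschitz, so completeness of R[i] is inherited
    from R. *)
Lemma complex_cauchy_cvg T (F : set_system T) {FF : ProperFilter F}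
    (f : T -> R[i]) :
    (forall e, 0 < e -> exists l, \forall t \near F, `|f t - l| < e) ->
  cvg (f @ F).
Proof.
move=> fe.
have part (p : R[i] -> R) : {morph p : x y / x - y} ->
    (forall a, `|p a|%:C <= `|a|) -> cvg (p (f t) @[t --> F]).
  move=> pB pa; apply/cauchy_cvgP/cauchy_exP => e e0.
  have [|l fl] := fe e%:C; first by rewrite ltcR.
  exists (p l); move: fl; apply: filterS => t ft.
  rewrite -ball_normE /= distrC -pB -ltcR.
  exact: le_lt_trans (pa _) ft.
have /cvg_ex[a fa] := part _ (raddfB (@complex.Re R)) norm_Re_le.
have /cvg_ex[b fb] := part _ (raddfB (@complex.Im R)) norm_Im_le.
by apply/cvg_ex; exists (a +i* b); exact: cvg_complex.
Qed.

(** The real and imaginary parts stay in a compact segment, where every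
    ultrafilter converges. *)
Lemma ultra_bounded_cvg T (U : set_system T) {UU : UltraFilter U}
    (f : T -> R[i]) (M : R[i]) :
  (\forall t \near U, `|f t| <= M) -> cvg (f @ U).
Proof.
move=> fM.
have /complex_realP[r Mr] : M \is Num.real.
  have [t ft] := filter_ex fM; have b0 : 0 <= M := le_trans (normr_ge0 _) ft.
  exact: ger0_real.
have part (p : R[i] -> R) : (forall a, `|p a|%:C <= `|a|) ->
    exists l : R, p (f t) @[t --> U] --> l.
  move=> pa.
  have pU : (p (f t) @[t --> U]) `[- r, r]%classic.
    move: fM; apply: filterS => t ft.
    by rewrite /= in_itv /= -ler_norml -lecR (le_trans (pa _)) // -Mr.
  have [l [_ cl]] := @segment_compact _ (- r) r _ (fmap_proper_filter _ _) pU.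
  exists l => A Al /=.
  have [//|UnA] := in_ultra_setVsetC (fun t => A (p (f t))) UU.
  by have [z [zA Az]] := cl (~` A) A UnA Al.
have [a fa] := part _ norm_Re_le; have [b fb] := part _ norm_Im_le.
by apply/cvg_ex; exists (a +i* b); exact: cvg_complex.
Qed.

End Scalars.

(** * The inner product and the Riesz representation theorem *)

Section HilbertSpace.
Context {R : realType} {H : hilbertType R}.
Implicit Types (x y z : H) (c : R[i]).

Lemma hdotDl x y z : '[x + y, z] = '[x, z] + '[y, z].
Proof. exact: linearDl. Qed.
Lemma hdotDr x y z : '[z, x + y] = '[z, x] + '[z, y].
Proof. exact: linearDr. Qed.
Lemma hdotZl c x y : '[c *: x, y] = c * '[x, y].
Proof. exact: linearZl_LR. Qed.
Lemma hdotZr c x y : '[x, c *: y] = Num.conj c * '[x, y].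
Proof. by rewrite linearZr_LR. Qed.
Lemma hdotNl x y : '[- x, y] = - '[x, y].
Proof. exact: linearNl. Qed.
Lemma hdotNr x y : '[x, - y] = - '[x, y].
Proof. exact: linearNr. Qed.
Lemma hdotBl x y z : '[x - y, z] = '[x, z] - '[y, z].
Proof. exact: linearBl. Qed.
Lemma hdotBr x y z : '[z, x - y] = '[z, x] - '[z, y].
Proof. exact: linearBr. Qed.
Lemma hdot0l x : '[0, x] = 0.
Proof. exact: linear0l. Qed.
Lemma hdot0r x : '[x, 0] = 0.
Proof. exact: linear0r. Qed.
Lemma hdotC x y : '[x, y] = Num.conj '[y, x].
Proof. by rewrite (@hermC _ false) expr0 mul1r. Qed.
Lemma hdotJ x y : Num.conj '[x, y] = '[y, x].
Proof. by rewrite [RHS]hdotC. Qed.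
Lemma normJ x : Num.conj `|x| = `|x|.
Proof. by rewrite geC0_conj. Qed.

(** Expand the squared norm of |y|^2 x - <x, y> y, which is |y|^2 times the
    difference of the squares of the two sides. *)
Lemma cauchy_schwarz x y : `|'[x, y]| <= `|x| * `|y|.
Proof.
have [->|y0] := eqVneq y 0; first by rewrite hdot0r normr0 mulr_ge0.
have yy : 0 < `|y| ^+ 2 by rewrite exprn_gt0 // normr_gt0.
rewrite -ler_sqr ?nnegrE ?mulr_ge0 // exprMn -(ler_pM2l yy).
have := dnorm_ge0 (hdot : {dot H for @Num.conj R[i]})
  (`|y| ^+ 2 *: x - '[x, y] *: y).
rewrite !(hdotBl, hdotBr, hdotZl, hdotZr) !hdot_norm normCK -subr_ge0.
rewrite !hdotJ rmorphXn /= normJ; congr (_ <= _); ring.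
Qed.

Lemma hdot_ext x y : (forall z, '[x, z] = '[y, z]) -> x = y.
Proof.
move=> xy; apply/eqP; rewrite -subr_eq0 -normr_eq0 -sqrf_eq0 -hdot_norm.
by rewrite hdotBl xy subrr.
Qed.

Lemma hdotr_cvg T (F : set_system T) {FF : Filter F} (f : T -> H) x y :
  f @ F --> x -> '[y, f t] @[t --> F] --> '[y, x].
Proof.
move=> fx; apply/cvgrPdist_le => e e0.
have y1 : 0 < `|y| + 1 by rewrite ltr_wpDl.
have /cvgrPdist_le/(_ (e / (`|y| + 1)) (divr_gt0 e0 y1)) := fx.
apply: filterS => t ft; rewrite -hdotBr (le_trans (cauchy_schwarz _ _)) //.
rewrite -[e](@divfK _ (`|y| + 1)) ?gt_eqF // mulrC.
by rewrite ler_pM // lerDl.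
Qed.

Lemma hdotl_cvg T (F : set_system T) {FF : Filter F} (f : T -> H) x y :
  f @ F --> x -> '[f t, y] @[t --> F] --> '[x, y].
Proof.
move=> fx; apply/cvgrPdist_le => e e0.
have /cvgrPdist_le/(_ e e0) := hdotr_cvg (FF := FF) (y := y) fx.
apply: filterS => t; rewrite -!hdotBr -hdotBl.
by rewrite -[X in _ -> X <= _]norm_conjC hdotJ.
Qed.

(** The representing vector is the minimizer of J x = |x|^2 - 2 Re (f x): the
    parallelogram law makes minimizing sequences Cauchy, and the first-order
    condition at the minimum is the claim.  The first-order condition is tested
    on the minimizing sequence itself, up to an error that vanishes, so that
    continuity of J is not used. *)
Lemma riesz (f : H -> R[i]) (M : R[i]) : 0 <= M ->
    (forall c x y, f (c *: x + y) = c * f x + f y) ->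
    (forall x, `|f x| <= M * `|x|) ->
  exists z, forall x, f x = '[x, z].
Proof.
move=> M0 lf fM.
pose J x : R[i] := '[x, x] - f x - Num.conj (f x).
have f0 : f 0 = 0 by have := fM 0; rewrite normr0 mulr0 normr_le0 => /eqP.
have fD x y : f (x + y) = f x + f y by rewrite -[x]scale1r lf mul1r scale1r.
have fZ c x : f (c *: x) = c * f x by rewrite -[c *: x]addr0 lf f0 addr0.
have J_ge x : - M ^+ 2 <= J x.
  have : 0 <= (`|x| - M) ^+ 2.
    by rewrite real_exprn_even_ge0 // rpredB // ger0_real.
  have h : f x + Num.conj (f x) <= 2 * (M * `|x|).
    by rewrite (le_trans (addJ_le _)) // ler_pM2l ?ltr0n.
  rewrite /J hdot_norm -2![0 <= _]subr_ge0 -subr_ge0 in h * => h2.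
  rewrite -subr_ge0; apply: le_trans (addr_ge0 h h2) _.
  by apply: le_of_eq; ring.
have [|m mJ mJe] := ex_minimizing (0 : H) _ J_ge.
  by rewrite rpredN rpredX // ger0_real.
have half (n : nat) : 0 < n.+1%:R^-1 :> R[i] by rewrite invr_gt0 ltr0n.
have [u um] := choice (fun n => mJe _ (half n)).
have J_par x y : `|x - y| ^+ 2 = 2 * (J x + J y) - 4 * J (2^-1 *: (x + y)).
  rewrite -hdot_norm /J fZ fD !(hdotDl, hdotDr, hdotZl, hdotZr, hdotNl, hdotNr).
  rewrite !(rmorphM, rmorphD) /= !fmorphV /= rmorph_nat.
  by field.
have u_cauchy n k N : (N <= n)%N -> (N <= k)%N ->
    `|u n - u k| ^+ 2 <= 4 * N.+1%:R^-1.
  move=> Nn Nk; rewrite J_par.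
  have le_inv p : (N <= p)%N -> J (u p) <= m + N.+1%:R^-1.
    move=> Np; apply: le_trans (ltW (um p)) _.
    by rewrite lerD2l lef_pV2 ?posrE ?ltr0n // ler_nat.
  have h1 : 0 <=
      2 * ((m + N.+1%:R^-1) + (m + N.+1%:R^-1) - (J (u n) + J (u k))).
    by rewrite pmulr_rge0 ?ltr0n // subr_ge0 lerD ?le_inv.
  have h2 : 0 <= 4 * (J (2^-1 *: (u n + u k)) - m).
    by rewrite pmulr_rge0 ?ltr0n // subr_ge0.
  rewrite -subr_ge0.
  by have := addr_ge0 h1 h2; congr (_ <= _); ring.
have /cauchy_cvgP/cvg_ex[z uz] : cauchy (u @ \oo).
  apply/cauchy_exP => e e0.
  have [|N Ne] := @ex_inv_succ_lt R (e ^+ 2 / 4).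
    by rewrite divr_gt0 ?exprn_gt0.
  exists (u N); exists N => // n /= Nn.
  rewrite -ball_normE /= -ltr_sqr ?nnegrE ?(ltW e0) //.
  by rewrite (le_lt_trans (u_cauchy _ _ N _ _)) // -ltr_pdivlMl // mulrC.
(* [J] at [u n - (p^-1 * Num.conj w) *: y] lies above [m], and [J (u n)] at
   most [n.+1%:R^-1] above [m]; the step is chosen so that the difference of
   the two values is at least [p^-1 * `|w| ^+ 2]. *)
exists z => y; pose p := `|y| ^+ 2 + 1.
have p0 : 0 < p by rewrite ltr_wpDl ?exprn_ge0.
have w_le n : `|'[y, u n] - f y| ^+ 2 <= p * n.+1%:R^-1.
  set w := '[y, u n] - f y; rewrite -ler_pdivrMl // -subr_ge0.
  have h1 : 0 <= J (u n - (p^-1 * Num.conj w) *: y) - m by rewrite subr_ge0.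
  have h2 : 0 <= m + n.+1%:R^-1 - J (u n) by rewrite subr_ge0 ltW.
  have h3 : 0 <= p^-1 ^+ 2 * `|w| ^+ 2.
    by rewrite mulr_ge0 // exprn_ge0 // invr_ge0 ltW.
  have := addr_ge0 (addr_ge0 h1 h2) h3; congr (_ <= _).
  have pJ : Num.conj p = p by rewrite geC0_conj // ltW.
  have fE : f y = '[y, u n] - w by rewrite /w opprB addrC subrK.
  clearbody w; rewrite /J -scaleNr fD fZ !(hdotDl, hdotDr, hdotZl, hdotZr) fE.
  rewrite !(rmorphM, rmorphD, rmorphN) /= !fmorphV /= pJ conjCK !hdotJ.
  have -> : '[y, y] = p - 1 by rewrite hdot_norm /p addrK.
  by rewrite normCK; field; rewrite gt_eqF //= nat1r pnatr_eq0.
suff fy : '[y, u n] @[n --> \oo] --> f y.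
  exact: (norm_cvg_unique fy (hdotr_cvg (y := y) uz)).
apply/cvgrPdist_le => e e0.
have [|N Ne] := @ex_inv_succ_lt R (p^-1 * e ^+ 2).
  by rewrite mulr_gt0 ?invr_gt0 ?exprn_gt0.
exists N => // n /= Nn; rewrite distrC -ler_sqr ?nnegrE ?(ltW e0) //.
rewrite (le_trans (w_le n)) // -ler_pdivlMl // (le_trans _ (ltW Ne)) //.
by rewrite lef_pV2 ?posrE ?ltr0n // ler_nat.
Qed.

End HilbertSpace.

(** * Bounded operators and their adjoints *)

Section Operators.
Context {R : realType} {H : hilbertType R}.
Implicit Types (x y z : H) (c K M r : R[i]) (A B S T : bop H).

Lemma bopD A x y : A (x + y) = A x + A y.
Proof. by rewrite -[x]scale1r bop_linear !scale1r. Qed.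
Lemma bop0 A : A 0 = 0.
Proof. by apply: (@addrI _ (A 0)); rewrite -bopD !addr0. Qed.
Lemma bopZ A c x : A (c *: x) = c *: A x.
Proof. by rewrite -[c *: x]addr0 bop_linear bop0 addr0. Qed.
Lemma bopN A x : A (- x) = - A x.
Proof. by rewrite -scaleN1r bopZ scaleN1r. Qed.
Lemma bopB A x y : A (x - y) = A x - A y.
Proof. by rewrite bopD bopN. Qed.
Lemma bop_mulE A B x : (A * B) x = A (B x). Proof. by []. Qed.
Lemma bop_oneE x : (1 : bop H) x = x. Proof. by []. Qed.
Lemma bop_zeroE x : (0 : bop H) x = 0. Proof. by []. Qed.
Lemma bop_oppE A x : (- A) x = - A x. Proof. by []. Qed.
Lemma bop_subE A B x : (A - B) x = A x - B x. Proof. by []. Qed.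
Lemma bop_scaleAl c A B : (c *: A) * B = c *: (A * B).
Proof. exact/bopP. Qed.
Lemma bop_scaleAr c A B : A * (c *: B) = c *: (A * B).
Proof. by apply/bopP => x; rewrite bop_mulE !bop_scaleE bopZ. Qed.
Definition pack_linear (f : H -> H) (lf : linear f) : {linear H -> H} :=
  HB.pack f (GRing.isLinear.Build _ _ _ _ f lf).
Definition bounded_by M A : Prop := forall x, `|A x| <= M * `|x|.

Lemma bop_bounded A : exists2 M, 0 <= M & bounded_by M A.
Proof.
pose g := pack_linear (@bop_linear _ _ A).
have /linear_bounded_continuous/linear_boundedP [M [Mr h]] : continuous g.
  exact: bop_continuous.
exists (`|M| + 1); first by rewrite addr_ge0.
move=> x; apply: (h (`|M| + 1)).
by rewrite (le_lt_trans (real_ler_norm Mr)) // ltrDl.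
Qed.

Lemma bop_of_bounded (f : H -> H) M : 0 <= M -> linear f ->
  (forall x, `|f x| <= M * `|x|) -> exists A : bop H, forall x, A x = f x.
Proof.
move=> M0 lf fM; pose g := pack_linear lf.
have cf : continuous f.
  apply: (proj1 (linear_bounded_continuous g)); apply/(linear_boundedP g).
  exists M; split; first by rewrite ger0_real.
  by move=> r Mr x; rewrite (le_trans (fM x)) // ler_wpM2r // ltW.
have bf : f \in bounded_op by apply/bounded_opP.
by exists (Bop bf).
Qed.

(** Apply [riesz] in the second variable for each value of the first. *)
Lemma bop_of_form (B : H -> H -> R[i]) M : 0 <= M ->
    (forall c x y z, B (c *: x + y) z = c * B x z + B y z) ->
    (forall c x y z, B z (c *: x + y) = Num.conj c * B z x + B z y) ->
    (forall x y, `|B x y| <= M * `|x| * `|y|) ->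
  exists T : bop H, forall x y, '[T x, y] = B x y.
Proof.
move=> M0 Bl Br BM.
have rep x : exists z, forall y, B x y = '[z, y].
  have [|||z zE] := @riesz _ _ (fun y => Num.conj (B x y)) (M * `|x|).
  - by rewrite mulr_ge0.
  - by move=> c y z; rewrite Br rmorphD rmorphM /= conjCK.
  - by move=> y; rewrite norm_conjC.
  by exists z => y; rewrite -[B x y]conjCK zE hdotJ.
have [f fE] := choice rep.
have lf : linear f.
  move=> c x y; apply: hdot_ext => z.
  by rewrite -fE Bl !fE hdotDl hdotZl.
have [|T TE] := @bop_of_bounded f M M0 lf; last first.
  by exists T => x y; rewrite TE fE.
move=> x; have := BM x (f x); rewrite fE hdot_norm normrX normr_id expr2.
have [->|fx0] := eqVneq (f x) 0; first by rewrite normr0 mulr_ge0.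
by rewrite ler_pM2r ?normr_gt0.
Qed.

(** The form (x, y) |-> <x, A y> is bounded, so an adjoint exists; then the
    choice made by [adj] is one. *)
Lemma adjE A x y : '[A x, y] = '[x, adj A y].
Proof.
suff [B BE] : exists B, forall x y, '[A x, y] = '[x, B y].
  have : [set B : bop H | forall x y, '[A x, y] = '[x, B y]] (adj A).
    by apply: xgetPex; exists B.
  exact.
have [M M0 AM] := bop_bounded A.
have [|||B BE] := @bop_of_form (fun y x => '[y, A x]) M M0.
- by move=> c u v w; rewrite hdotDl hdotZl.
- by move=> c u v w; rewrite bopD bopZ hdotDr hdotZr.
- move=> u v; rewrite (le_trans (cauchy_schwarz _ _)) // mulrAC [leRHS]mulrC.
  by rewrite ler_wpM2l.
by exists B => u v; rewrite hdotC -BE hdotJ.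
Qed.

Lemma adjEr A x y : '[x, A y] = '[adj A x, y].
Proof. by rewrite hdotC adjE hdotJ. Qed.

Lemma adj_unique A B : (forall x y, '[A x, y] = '[x, B y]) -> adj A = B.
Proof.
move=> AB; apply/bopP => y; apply: hdot_ext => z.
by rewrite hdotC [RHS]hdotC -adjE AB.
Qed.

Lemma bop_adjK A : adj (adj A) = A.
Proof. by apply: adj_unique => x y; rewrite adjEr. Qed.
Lemma bop_adjM A B : adj (A * B) = adj B * adj A.
Proof. by apply: adj_unique => x y; rewrite !bop_mulE !adjE. Qed.
Lemma bop_adj1 : adj (1 : bop H) = 1.
Proof. exact: adj_unique. Qed.
Lemma bop_adjD A B : adj (A + B) = adj A + adj B.
Proof. by apply: adj_unique => x y; rewrite !bop_addE hdotDl hdotDr !adjE. Qed.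
Lemma bop_adjN A : adj (- A) = - adj A.
Proof. by apply: adj_unique => x y; rewrite !bop_oppE hdotNl hdotNr !adjE. Qed.

Lemma bop_adjZ c A : adj (c *: A) = Num.conj c *: adj A.
Proof.
by apply: adj_unique => x y; rewrite !bop_scaleE hdotZl hdotZr conjCK adjE.
Qed.

Lemma bop_adjB A B : adj (A - B) = adj A - adj B.
Proof. by rewrite bop_adjD bop_adjN. Qed.

(** This follows from |adj A x|^2 = <x, A (adj A x)>. *)
Lemma adj_bound A M : 0 <= M -> bounded_by M A -> bounded_by M (adj A).
Proof.
move=> M0 AM x; have [->|fx0] := eqVneq (adj A x) 0.
  by rewrite normr0 mulr_ge0.
rewrite -(ler_pM2l (_ : 0 < `|adj A x|)) ?normr_gt0 // -expr2 -hdot_norm.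
rewrite -[leLHS]ger0_norm; last by rewrite hdot_norm exprn_ge0.
rewrite -adjEr (le_trans (cauchy_schwarz _ _)) // mulrC mulrCA mulrA.
by rewrite [leRHS](_ : _ = (M * `|adj A x|) * `|x|) ?ler_wpM2r //; ring.
Qed.

Lemma polarization S x y : 4 * '[S x, y] =
  '[S (x + y), x + y] - '[S (x - y), x - y] +
  ('i * '[S (x + 'i *: y), x + 'i *: y] - 'i * '[S (x - 'i *: y), x - 'i *: y]).
Proof.
rewrite !(bopD, bopN, bopZ) !(hdotDl, hdotDr, hdotNl, hdotNr, hdotZl, hdotZr).
by rewrite conjCi; move: (sqrCi R[i]) => i2; ring: i2.
Qed.

(** Polarization bounds 4 |<S x, y>| by 4 K (|x|^2 + |y|^2), thanks to the
    parallelogram law; take for y the multiple of S x of the same norm as x. *)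
Lemma bounded_by_quadratic_form S K : 0 <= K ->
  (forall x, `|'[S x, x]| <= K * `|x| ^+ 2) -> bounded_by (2 * K) S.
Proof.
move=> K0 SK x; have K2 : 0 <= 2 * K * `|x| by rewrite !mulr_ge0.
have [->|Sx0] := eqVneq (S x) 0; first by rewrite normr0.
have [x0|x0] := eqVneq x 0; first by rewrite x0 bop0 eqxx in Sx0.
rewrite -normr_gt0 in Sx0; rewrite -normr_gt0 in x0.
pose y := (`|x| / `|S x|) *: S x.
have ny : `|y| = `|x|.
  by rewrite normrZ ger0_norm ?divr_ge0 // divfK // gt_eqF.
have par (v w : H) : `|v + w| ^+ 2 + `|v - w| ^+ 2 =
    2 * (`|v| ^+ 2 + `|w| ^+ 2).
  by rewrite -!hdot_norm !(hdotDl, hdotDr, hdotNl, hdotNr); ring.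
have pari (v w : H) : `|v + 'i *: w| ^+ 2 + `|v - 'i *: w| ^+ 2 =
    2 * (`|v| ^+ 2 + `|w| ^+ 2).
  by rewrite par normrZ normCi mul1r.
have h4 : 4 * `|'[S x, y]| <= 4 * (2 * K * `|x| ^+ 2).
  rewrite -[leLHS](_ : `|4 * '[S x, y]| = _); last by rewrite normrM normr_nat.
  rewrite polarization.
  rewrite (le_trans (ler_normD _ _)) //.
  apply: (@le_trans _ _ ((K * `|x + y| ^+ 2 + K * `|x - y| ^+ 2) +
     (K * `|x + 'i *: y| ^+ 2 + K * `|x - 'i *: y| ^+ 2))); last first.
    by rewrite -!mulrDr par pari ny; apply: le_of_eq; ring.
  by rewrite lerD // (le_trans (ler_normB _ _)) // lerD // normrM normCi mul1r.
move: h4; rewrite ler_pM2l ?ltr0n // hdotZr rmorphM fmorphV /= !normJ.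
rewrite hdot_norm normrM normrX normr_id ger0_norm ?divr_ge0 // => h.
rewrite -(ler_pM2l x0); apply: le_trans (le_trans _ h) _.
  by rewrite expr2 mulrA divfK // gt_eqF.
by apply: le_of_eq; ring.
Qed.

(** A ball of radius r contains two antipodal points x + v and x - v at distance
    r / 2 of its centre.  Since 2 T v is the difference of their images, one of
    them has an image at least as large as T v, which can be made large for some
    member of an unbounded family.  By continuity the image stays large on a
    small ball around that point. *)
Lemma nested_ball_step (T : nat -> bop H) (n : nat) x r :
    (forall M, 0 <= M -> exists k, ~ bounded_by M (T k)) -> 0 < r ->
  exists x' r', [/\ 0 < r', r' <= n.+1%:R^-1,
    forall y, `|y - x'| <= r' -> `|y - x| <= r &
    exists k, forall y, `|y - x'| <= r' -> n%:R <= `|T k y|].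
Proof.
move=> Tunb r0.
have n1 : 0 < n.+1%:R :> R[i] by rewrite ltr0n.
have r2 : 0 < 2 / r by rewrite divr_gt0.
have M0 : 0 <= 2 / r * n.+1%:R by rewrite mulr_ge0 // ltW.
have [k /existsNP[u /negP]] := Tunb _ M0.
rewrite -real_ltNge ?ger0_real ?(mulr_ge0 M0 (normr_ge0 u)) // => uT.
have u0 : 0 < `|u|.
  rewrite lt_neqAle normr_ge0 andbT eq_sym normr_eq0; apply/eqP => u0.
  by move: uT; rewrite u0 bop0 !normr0 mulr0 ltxx.
pose v := (r / 2 / `|u|) *: u.
have c0 : 0 < r / 2 / `|u| by rewrite !divr_gt0.
have nv : `|v| = r / 2.
  by rewrite normrZ gtr0_norm // divfK // gt_eqF.
have Tv : n.+1%:R <= `|T k v|.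
  rewrite bopZ normrZ gtr0_norm // -ler_pdivrMl // ltW //.
  apply: le_lt_trans uT; apply: le_of_eq.
  by field; rewrite !gt_eqF //= nat1r.
have [x' [xx' Tx']] : exists x', `|x' - x| = r / 2 /\ n.+1%:R <= `|T k x'|.
  have [h|/negP h] := boolP (n.+1%:R <= `|T k (x + v)|).
    by exists (x + v); rewrite addrC addKr.
  exists (x - v); split; first by rewrite addrC addKr normrN.
  have h2 : 2 * n.+1%:R <= `|T k (x + v)| + `|T k (x - v)|.
    rewrite (le_trans _ (ler_normB _ _)) // -bopB opprB [x + v]addrC -addrA.
    rewrite [x + _]addrCA subrr addr0.
    by rewrite bopD -mulr2n normrMn mulr_natl lerMn2r.
  have {}h : `|T k (x + v)| <= n.+1%:R.
    by move/negP : h; rewrite -real_ltNge ?normr_real ?realn // => /ltW.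
  have := lerB h2 h; rewrite addrAC subrr add0r; apply: le_trans.
  by rewrite mulr_natl mulr2n addrK.
have [B B0 BT] := bop_bounded (T k).
(* [s^-1] is at most [r / 2] and [n.+1%:R^-1], and [B * s^-1] at most [1] *)
pose s := 2 / r + B + n.+1%:R.
have s0 : 0 < s by rewrite ltr_wpDl // addr_ge0 // ltW.
exists x', s^-1; split.
- by rewrite invr_gt0.
- by rewrite lef_pV2 ?posrE // lerDr addr_ge0 // ltW.
- move=> y yx'; rewrite -(subrKA x') (le_trans (ler_normD _ _)) // xx'.
  rewrite [leRHS](splitr r) lerD // (le_trans yx') //.
  rewrite -[leRHS]invrK lef_pV2 ?posrE ?invr_gt0 ?divr_gt0 // invf_div.
  by rewrite /s -addrA lerDl addr_ge0 // ltW.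
- exists k => y yx'.
  have : n.+1%:R <= `|T k y| + 1.
    apply: le_trans Tx' _; rewrite -[X in T k X](subrK y) bopD.
    rewrite (le_trans (ler_normD _ _)) // addrC lerD // (le_trans (BT _)) //.
    rewrite distrC (le_trans (ler_wpM2l B0 yx')) // ler_pdivrMr // mul1r.
    by rewrite /s addrAC lerDr addr_ge0 // ltW.
  by rewrite -natr1 lerD2r.
Qed.

(** If the family were unbounded, iterating [nested_ball_step] would give
    nested balls whose common point has an unbounded sequence of images. *)
Lemma uniform_boundedness (T : nat -> bop H) :
    (forall x, exists M, forall n, `|T n x| <= M) ->
  exists2 M, 0 <= M & forall n, bounded_by M (T n).
Proof.
move=> Tx; apply: contrapT => noM.
have Tunb M : 0 <= M -> exists k, ~ bounded_by M (T k).
  move=> M0; apply/existsNP => TM; apply: noM; exists M => //.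
have stepP (np : nat * (H * R[i])) : exists q : H * R[i], 0 < np.2.2 ->
    [/\ 0 < q.2, q.2 <= np.1.+1%:R^-1,
    forall y, `|y - q.1| <= q.2 -> `|y - np.2.1| <= np.2.2 &
    exists k, forall y, `|y - q.1| <= q.2 -> np.1%:R <= `|T k y|].
  have [r0|] := boolP (0 < np.2.2); last by exists (0, 0).
  by have [x' [r' h]] := nested_ball_step np.1 np.2.1 Tunb r0; exists (x', r').
have [f fP] := choice stepP.
pose p := fix p n : H * R[i] := if n is m.+1 then f (m, p m) else (0, 1).
have p0 n : 0 < (p n).2.
  by elim: n => [|n IH] /=; [exact: ltr01|case: (fP (n, p n) IH)].
have pP n := fP (n, p n) (p0 n).
have nested n m : (n <= m)%N -> forall y,
    `|y - (p m).1| <= (p m).2 -> `|y - (p n).1| <= (p n).2.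
  move=> /subnK <-; elim: (m - n)%N => [//|k IH] y hy; apply: IH.
  by have [_ _ h _] := pP (k + n)%N; exact: h.
have centre n m : (n <= m)%N -> `|(p m).1 - (p n).1| <= (p n).2.
  by move=> nm; apply: (nested n m nm); rewrite subrr normr0 ltW.
have /cauchy_cvgP/cvg_ex[z pz] : cauchy ((fun n => (p n).1) @ \oo).
  apply/cauchy_exP => e e0; have [N Ne] := ex_inv_succ_lt e0.
  exists (p N.+1).1; exists N.+1 => // n /= Nn.
  rewrite -ball_normE /= distrC (le_lt_trans (centre _ _ Nn)) //.
  by apply: le_lt_trans Ne; case: (pP N).
have zp n : `|z - (p n).1| <= (p n).2.
  apply: (@limit_norm_le _ _ _ \oo _ (fun m => (p m).1 - (p n).1)).
    by apply: cvgB; [exact: pz|exact: cvg_cst].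
  by exists n => // m /= nm; exact: centre.
have [M TM] := Tx z.
have nM n : n%:R <= M.
  have [_ _ _ [k Tk]] := pP n; apply: le_trans (TM k); exact/Tk/(zp n.+1).
have M1 : 0 < M + 1 by rewrite ltr_wpDl // (nM 0%N).
have [|N] := @ex_inv_succ_lt R (M + 1)^-1; first by rewrite invr_gt0.
rewrite ltf_pV2 ?posrE ?ltr0n // => h.
have := lt_le_trans h (nM N.+1).
by rewrite gtrDl ltr10.
Qed.

End Operators.

(** * Ultraweak convergence of bounded families *)

Section Ultraweak.
Context {R : realType} {H : hilbertType R}.
Implicit Types (x y : H) (M : R[i]) (A T : bop H) (u v : nat -> H).

(** The terms are dominated by M (|u n|^2 + |v n|^2); the point is that the
    resulting N does not depend on the operator, only on its bound. *)
Lemma series_form_tail u v M e : square_summable u -> square_summable v ->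
    0 <= M -> 0 < e ->
  exists N, forall A, bounded_by M A -> forall m, (N <= m)%N ->
    `|series (fun n => '[A (u n), v n]) m - series (fun n => '[A (u n), v n]) N|
      <= e.
Proof.
move=> su sv M0 e0; pose b n : R[i] := `|u n| ^+ 2 + `|v n| ^+ 2.
have /cvg_ex[l bl] : cvgn (series b).
  have -> : series b = series (fun n => `|u n| ^+ 2 : R[i]) +
                       series (fun n => `|v n| ^+ 2 : R[i]).
    by rewrite seriesD.
  exact: is_cvgD su sv.
have M1 : 0 < M + 1 by rewrite ltr_wpDl.
have [|N _ Nl] := proj1 (@cvgrPdist_le _ _ _ _ _ _ _) bl (e / (M + 1) / 2).
  by rewrite divr_gt0 // divr_gt0.
exists N => A AM m Nm; rewrite sub_series Nm.
apply: le_trans (ler_norm_sum _ _ _) _.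
apply: (@le_trans _ _ (\sum_(N <= n < m) M * b n)).
  apply: ler_sum => n _; apply: le_trans (cauchy_schwarz _ _) _.
  apply: le_trans (ler_wpM2r (normr_ge0 _) (AM _)) _.
  by rewrite -mulrA ler_wpM2l // prod_le_sum_sqr.
have bm : \sum_(N <= n < m) b n <= e / (M + 1).
  rewrite -[leLHS]ger0_norm; last first.
    by apply: sumr_ge0 => n _; rewrite addr_ge0 // exprn_ge0.
  have := sub_series b N m; rewrite Nm => <-.
  rewrite -(subrKA l) (le_trans (ler_normD _ _)) // [leRHS]splitr lerD //.
    by rewrite distrC; exact: Nl.
  by apply: Nl => /=.
rewrite -mulr_sumr; apply: le_trans (ler_wpM2l M0 bm) _.
rewrite mulrCA; apply: ler_piMr; first exact: ltW.
by rewrite ler_pdivrMr // mul1r lerDl.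
Qed.

Lemma cvg_series_form A u v : square_summable u -> square_summable v ->
  cvgn (series (fun n => '[A (u n), v n])).
Proof.
move=> su sv; have [M M0 AM] := bop_bounded A.
apply: complex_cauchy_cvg => e e0.
have [|N NA] := series_form_tail su sv M0 (_ : 0 < e / 2).
  by rewrite divr_gt0.
exists (series (fun n => '[A (u n), v n]) N); exists N => // m /= Nm.
by rewrite (le_lt_trans (NA _ AM _ Nm)) // ltr_pdivrMr // ltr_pMr // ltr1n.
Qed.

(** The tails of the series defining an ultraweak functional are uniformly
    small on bounded sets, and its partial sums are weakly continuous. *)
Lemma ultraweak_of_bounded_weak (F : set_system (bop H)) T M :
    ProperFilter F -> 0 <= M ->
    (\forall A \near F, bounded_by M A) ->
    (forall x y, '[A x, y] @[A --> F] --> '[T x, y]) ->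
  ultraweak_cvg F T.
Proof.
move=> FF M0 FM FT u v su sv; apply/cvgrPdist_le => e e0.
have e3 : 0 < e / 3 by rewrite divr_gt0.
have [M' M'0 TM'] := bop_bounded T.
have MM : 0 <= M + M' by rewrite addr_ge0.
have [N NA] := series_form_tail su sv MM e3.
pose s A := series (fun n => '[A (u n), v n]).
have tail A : bounded_by (M + M') A ->
    `|normal_form u v A - s A N| <= e / 3.
  move=> AM; apply: (@limit_norm_le _ _ _ \oo _ (fun m => s A m - s A N)).
    by apply: cvgB; [exact: cvg_series_form|exact: cvg_cst].
  by exists N => // m /= Nm; exact: NA.
have sT : s A N @[A --> F] --> s T N.
  elim: (N) => [|k IH].
    under eq_cvg do rewrite /s seriesEord /= big_ord0.
    by rewrite /s seriesEord /= big_ord0; exact: cvg_cst.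
  under eq_cvg do rewrite /s seriesSr.
  rewrite /s seriesSr; apply: cvgD; first exact: IH.
  exact: FT.
have sTe : \forall A \near F, `|s T N - s A N| <= e / 3.
  by move/cvgrPdist_le : sT; exact.
apply: filterS (filterI FM sTe) => A [AM ATN].
have AMM : bounded_by (M + M') A.
  by move=> x; apply: le_trans (AM x) _; rewrite ler_wpM2r // lerDl.
have TMM : bounded_by (M + M') T.
  by move=> x; apply: le_trans (TM' x) _; rewrite ler_wpM2r // lerDr.
have -> : normal_form u v T - normal_form u v A =
    (normal_form u v T - s T N) + (s T N - s A N) -
    (normal_form u v A - s A N) by ring.
have -> : e = e / 3 + e / 3 + e / 3 by field.
rewrite (le_trans (ler_normB _ _)) // lerD ?tail //.
by rewrite (le_trans (ler_normD _ _)) // lerD ?tail.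
Qed.

Lemma square_summable_delta x :
  square_summable (fun n => if n is 0%N then x else 0).
Proof.
apply/cvg_ex; exists (`|x| ^+ 2).
apply: cvg_near_cst; exists 1%N => // -[|n] //= _.
rewrite /series /= big_nat_recl // big1 ?addr0 // => i _.
by rewrite normr0 expr0n.
Qed.

(** The functional A |-> <A x, y> is the ultraweak functional of the sequences
    (x, 0, 0, ...) and (y, 0, 0, ...). *)
Lemma weak_of_ultraweak (F : set_system (bop H)) T :
  Filter F -> ultraweak_cvg F T ->
  forall x y, '[A x, y] @[A --> F] --> '[T x, y].
Proof.
move=> FF FT x y.
have := FT _ _ (@square_summable_delta x) (@square_summable_delta y).
suff nfE A : normal_form (fun n => if n is 0%N then x else 0)
    (fun n => if n is 0%N then y else 0) A = '[A x, y].
  by rewrite nfE (funext nfE).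
apply: lim_near_cst; first exact: norm_hausdorff.
exists 1%N => // -[|n] //= _.
rewrite /series /= big_nat_recl // big1 ?addr0 // => i _.
by rewrite hdot0r.
Qed.

End Ultraweak.

(** * The variance of a unital completely positive map *)

Section UnitalCP.
Context {R : realType} {H : hilbertType R}.
Variable phi : bop H -> bop H.
Hypotheses (phi_lin : linear phi) (phi_cp : completely_positive phi).
Hypothesis phi1 : phi 1 = 1.
Implicit Types (x y z : H) (c M : R[i]) (a b S : bop H).

Lemma opmapD a b : phi (a + b) = phi a + phi b.
Proof. by rewrite -[a]scale1r phi_lin !scale1r. Qed.
Lemma opmap0 : phi 0 = 0.
Proof. by apply: (@addrI _ (phi 0)); rewrite -opmapD !addr0. Qed.
Lemma opmapZ c a : phi (c *: a) = c *: phi a.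
Proof. by rewrite -[c *: a]addr0 phi_lin opmap0 addr0. Qed.
Lemma opmapN a : phi (- a) = - phi a.
Proof. by rewrite -scaleN1r opmapZ scaleN1r. Qed.
Lemma opmapB a b : phi (a - b) = phi a - phi b.
Proof. by rewrite opmapD opmapN. Qed.
Definition positive_op S := forall x, 0 <= '[S x, x].
Lemma positive_op1 : positive_op 1.
Proof. by move=> x; rewrite hdot_norm exprn_ge0. Qed.

Lemma positive_op_gap a M : bounded_by M a ->
  positive_op ((M ^+ 2 *: (1 : bop H) : bop H) - adj a * a).
Proof.
move=> aM x; rewrite bop_subE bop_scaleE bop_mulE hdotBl hdotZl -adjEr.
rewrite !hdot_norm -exprMn subr_ge0 ler_sqr ?nnegrE //.
by rewrite (le_trans _ (aM x)).
Qed.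

(** The matrix of the adj (a i) * S * a j is positive, since its form at
    (x i) is that of S at the sum of the a i (x i).  In a dilation with
    representation pi, the right-hand side is <pi(S) w, w> for
    w = sum_i pi(a i) V (x i); this is how the next lemmas are found. *)
Lemma cp_gram S n (a : 'I_n -> bop H) (x : 'I_n -> H) : positive_op S ->
  0 <= \sum_i \sum_j '[phi (adj (a i) * S * a j) (x j), x i].
Proof.
move=> S0; have := @phi_cp n (\matrix_(i, j) (adj (a i) * S * a j)) _ x.
under eq_bigr do under eq_bigr do rewrite !mxE.
apply=> y; under eq_bigr do under eq_bigr do rewrite !mxE !bop_mulE -adjEr.
have := S0 (\sum_j a j (y j)); congr (_ <= _).
rewrite linear_sumr; apply: eq_bigr => i _.
by rewrite (big_morph S (bopD S) (bop0 S)) linear_sumlz.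
Qed.

Lemma cp_gram1 S a x : positive_op S -> 0 <= '[phi (adj a * S * a) x, x].
Proof.
move=> S0; have := cp_gram (fun=> a) (fun=> x : H) S0 (n := 1).
by rewrite !big_ord_recl !big_ord0 /= !addr0.
Qed.

Lemma cp_gram2 S a b x y : positive_op S ->
  0 <= '[phi (adj a * S * a) x, x] + '[phi (adj a * S * b) y, x] +
       ('[phi (adj b * S * a) x, y] + '[phi (adj b * S * b) y, y]).
Proof.
move=> S0; have := cp_gram (fun i : 'I_2 => if i == 0 then a else b)
  (fun i : 'I_2 => if i == 0 then x else y) S0.
by rewrite !big_ord_recl !big_ord0 /= !addr0.
Qed.

Lemma cp_gram3 a b d x y z :
  0 <= '[phi (adj a * a) x, x] + '[phi (adj a * b) y, x] +
         '[phi (adj a * d) z, x] +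
       ('[phi (adj b * a) x, y] + '[phi (adj b * b) y, y] +
         '[phi (adj b * d) z, y]) +
       ('[phi (adj d * a) x, z] + '[phi (adj d * b) y, z] +
         '[phi (adj d * d) z, z]).
Proof.
have := cp_gram (fun i : 'I_3 => if i == 0 then a else if i == 1 then b else d)
  (fun i : 'I_3 => if i == 0 then x else if i == 1 then y else z) positive_op1.
by rewrite !big_ord_recl !big_ord0 /= !addr0 !addrA !mulr1.
Qed.

(** By [cp_gram2] at (1, u) and (a, v), the number
    <phi a v, u> + <phi (adj a) u, v> is real for all u and v.  Replacing v by
    i v shows that its two terms are conjugate. *)
Lemma cp_adj a : phi (adj a) = adj (phi a).
Proof.
rewrite -(adj_unique (A := phi (adj a)) (B := phi a)) ?bop_adjK // => x y.
have real_sum u v : '[phi a v, u] + '[phi (adj a) u, v] \is Num.real.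
  have := cp_gram2 1 a u v positive_op1.
  have := cp_gram1 1 u positive_op1.
  have := cp_gram1 a v positive_op1.
  rewrite bop_adj1 !mulr1 !mul1r => /ger0_real h1 /ger0_real h2 /ger0_real h.
  have := rpredB (rpredB h h1) h2.
  rewrite (_ : _ - _ - _ = '[phi a v, u] + '[phi (adj a) u, v]) //.
  ring.
have /CrealP := real_sum x y; have /CrealP := real_sum x ('i *: y).
rewrite bopZ !hdotZl !hdotZr !(rmorphD, rmorphM) /= !conjCK conjCi.
move=> h1 h2; apply/eqP; rewrite [X in _ == X]hdotC -subr_eq0.
have -> : '[phi (adj a) x, y] - Num.conj '[phi a y, x] =
    (('[phi a y, x] + '[phi (adj a) x, y]) -
     (Num.conj '[phi a y, x] + Num.conj '[phi (adj a) x, y])) / 2 +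
    ((- 'i * Num.conj '[phi a y, x] + 'i * Num.conj '[phi (adj a) x, y]) -
     ('i * '[phi a y, x] + - 'i * '[phi (adj a) x, y])) / (2 * 'i).
  by field; rewrite neq0Ci.
by rewrite h1 h2 !subrr !mul0r addr0.
Qed.

(** The quadratic form of phi (adj a * a) - adj (phi a) * phi a: in a dilation
    phi X = adj V * pi(X) * V, it is the squared distance of pi(a) V x to the
    range of V. *)
Definition cp_var a x := '[phi (adj a * a) x, x] - '[phi a x, phi a x].

(** This is the Schwarz inequality, from [cp_gram2] at (a, x) and
    (1, - phi a x). *)
Lemma cp_var_ge0 a x : 0 <= cp_var a x.
Proof.
have := cp_gram2 a 1 x (- phi a x) positive_op1.
rewrite !bop_adj1 !mulr1 !mul1r phi1 bop_oneE cp_adj bopN !hdotNl !hdotNr.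
by rewrite -adjEr opprK; congr (_ <= _); rewrite /cp_var; ring.
Qed.

Lemma cp_contractive a M : 0 <= M -> bounded_by M a -> bounded_by M (phi a).
Proof.
move=> M0 aM x.
have h1 := cp_var_ge0 a x.
have h2 : 0 <= M ^+ 2 * '[x, x] - '[phi (adj a * a) x, x].
  have := cp_gram1 1 x (positive_op_gap aM).
  rewrite bop_adj1 mulr1 mul1r opmapB opmapZ phi1 bop_subE bop_scaleE.
  by rewrite hdotBl hdotZl.
rewrite -ler_sqr ?nnegrE ?mulr_ge0 // exprMn -!hdot_norm -subr_ge0.
by have := addr_ge0 h1 h2; congr (_ <= _); rewrite /cp_var; ring.
Qed.

(** The right-hand side is the squared distance from pi(a) V x to V y, in the
    notation of [cp_var]; it is minimal at y = phi a x. *)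
Lemma cp_var_le_dist a x y :
  cp_var a x <=
    '[phi (adj a * a) x, x] - '[phi a x, y] - '[y, phi a x] + '[y, y].
Proof.
rewrite -subr_ge0 /cp_var.
have : 0 <= '[phi a x - y, phi a x - y] by rewrite hdot_norm exprn_ge0.
by rewrite !(hdotBl, hdotBr); congr (_ <= _); ring.
Qed.

Lemma cp_varZ c a x : cp_var (c *: a) x = `|c| ^+ 2 * cp_var a x.
Proof.
rewrite /cp_var bop_adjZ.
have -> : (Num.conj c *: adj a) * (c *: a) = `|c| ^+ 2 *: (adj a * a).
  by apply/bopP => y; rewrite !(bop_mulE, bop_scaleE) bopZ scalerA normCK mulrC.
rewrite !opmapZ !bop_scaleE !(hdotZl, hdotZr) normCK; ring.
Qed.

(** Parallelogram identity: the difference of the two sides is the variance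
    of a - b. *)
Lemma cp_varD a b x : cp_var (a + b) x <= 2 * cp_var a x + 2 * cp_var b x.
Proof.
rewrite -subr_ge0; have := cp_var_ge0 (a - b) x; congr (_ <= _).
rewrite /cp_var !(bop_adjD, bop_adjN) !(mulrDl, mulrDr, mulrN, mulNr).
rewrite !(opmapD, opmapN).
rewrite !(bop_addE, bop_oppE, hdotDl, hdotDr, hdotNl, hdotNr).
ring.
Qed.

(** Put z = phi b x and w = phi a z.  In the notation of [cp_var], the distance
    of pi(ab) V x to the range of V is at most its distance to V w, and
      pi(ab) V x - V w = pi(a) (pi(b) V x - V z) + (pi(a) V z - V w).
    The first summand is bounded by M times the distance of pi(b) V x to V z,
    and the squared norm of the sum by twice the sum of the squared norms. *)
Lemma cp_varM a b x M : 0 <= M -> bounded_by M a ->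
  cp_var (a * b) x <= 2 * M ^+ 2 * cp_var b x + 2 * cp_var a (phi b x).
Proof.
move=> M0 aM; set z := phi b x; set w := phi a z.
(* In the notation of [cp_var], the subtracted term is the squared norm of
   pi(a) (pi(b) V x - V z). *)
have h1 : 0 <= M ^+ 2 * cp_var b x - ('[phi (adj b * adj a * a * b) x, x] -
    '[phi (adj b * adj a * a) z, x] - '[phi (adj a * a * b) x, z] +
    '[phi (adj a * a) z, z]).
  have := cp_gram2 b 1 x (- z) (positive_op_gap aM).
  rewrite !bop_adj1 !mulr1 !mul1r !(mulrBl, mulrBr) !mulrA.
  rewrite !(bop_scaleAl, bop_scaleAr) !(mulr1, mul1r) !opmapB !opmapZ phi1.
  rewrite cp_adj !bop_subE !bop_scaleE bop_oneE !hdotNr !bopN.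
  rewrite !(hdotBl, hdotZl, hdotNl).
  by rewrite -adjEr -/z; congr (_ <= _); rewrite /cp_var -/z; ring.
have h2 := cp_var_le_dist (a * b) x w.
(* For p = pi(ab) V x, q = pi(a) V z and r = V w, the positivity of the squared
   norm of p - 2 q + r says that |p - r|^2 <= 2 |p - q|^2 + 2 |q - r|^2. *)
have h3 := cp_gram3 (a * b) a 1 x (- 2 *: z) w.
rewrite -subr_ge0 in h2; rewrite -subr_ge0.
have h0 : 0 <= 2 :> R[i] by rewrite ler0n.
have := addr_ge0 (addr_ge0 (mulr_ge0 h0 h1) h2) h3; congr (_ <= _).
rewrite /cp_var !bop_adjM !bop_adj1 !mulr1 !mul1r !mulrA phi1 bop_oneE.
rewrite -bop_adjM !cp_adj !bopZ !hdotZr !hdotZl rmorphN rmorph_nat -!adjEr.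
by rewrite -/z -/w; ring.
Qed.

End UnitalCP.

(** * The generator domain consists of the operators with Lipschitz orbit *)

Section Dini.
Context {R : realType}.

Lemma within_ge0_dist_le (F : R -> R[i]) (u : R) (e : R[i]) :
    {within `[0, +oo[, continuous F} -> 0 <= u -> 0 < e ->
  exists2 r : R, 0 < r &
    forall s, 0 <= s -> `|u - s| < r -> `|F u - F s| <= e.
Proof.
move=> /subspace_continuousP cF u0 e0.
have uI : `[0, +oo[%classic u by rewrite /= in_itv /= u0.
have /cvgrPdist_le/(_ _ e0) := cF u uI.
rewrite near_withinE => /nbhs_ballP[r r0 h].
by exists r => // s s0 us; apply: h => //=; rewrite in_itv /= s0.
Qed.

(** By continuity, the points s of [0, d] with |F s - F 0| <= c s have a
    greatest one; were it less than d, a small step from it would reach a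
    greater one.  Only one step at each scale is required at
    each point, which is what convergence along an ultrafilter provides. *)
Lemma dini_le (F : R -> R[i]) (d : R) (c : R[i]) :
    {within `[0, +oo[, continuous F} -> 0 <= d -> 0 <= c ->
    (forall s, 0 <= s < d -> forall tau, 0 < tau ->
       exists2 t : R, 0 < t < tau & `|F (s + t) - F s| <= c * t%:C) ->
  `|F d - F 0| <= c * d%:C.
Proof.
move=> cF d0 c0 step.
pose E := [set s | 0 <= s <= d /\ `|F s - F 0| <= c * s%:C].
have E0 : E 0 by rewrite /E /= lexx d0 subrr normr0 mulr0.
have supE : has_sup E by split; [exists 0|exists d => s [/andP[]]].
have u0 : 0 <= sup E by apply: sup_upper_bound.
have ud : sup E <= d by apply: ge_sup; [exists 0|move=> s [/andP[]]].
have Eu : E (sup E).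
  split; first by rewrite u0.
  apply/ler_addgt0Pr => e e0.
  have [r r0 Fr] := within_ge0_dist_le cF u0 e0.
  have [s Es us] := sup_adherent r0 supE.
  have su : s <= sup E by apply: sup_upper_bound.
  case: Es => /andP[s0 sd] Fs.
  rewrite -(subrKA (F s)) addrC (le_trans (ler_normD _ _)) // lerD //.
    by rewrite (le_trans Fs) // ler_wpM2l // lecR.
  by apply: Fr => //; rewrite ger0_norm ?subr_ge0 // ltrBlDr -ltrBlDl.
have [-> //|uNd] := eqVneq d (sup E); first by case: Eu.
have lud : sup E < d by rewrite lt_neqAle eq_sym uNd.
have sd : 0 < d - sup E by rewrite subr_gt0.
have [|t /andP[t0 td] Ft] := step (sup E) _ (d - sup E) sd; first by rewrite u0.
have : E (sup E + t).
  split; first by rewrite addr_ge0 ?(ltW t0) //= -lerBrDl ltW.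
  have -> : F (sup E + t) - F 0 =
      (F (sup E) - F 0) + (F (sup E + t) - F (sup E)) by ring.
  rewrite rmorphD mulrDr (le_trans (ler_normD _ _)) // lerD //.
  by case: Eu.
by move/(sup_upper_bound supE); rewrite gerDl leNgt t0.
Qed.

End Dini.

Section Generator.
Context {R : realType} {H : hilbertType R}.
Variable phi : R -> bop H -> bop H.
Hypothesis hphi : CP_semigroup phi.
Implicit Types (x y : H) (M : R[i]) (A B T : bop H) (s t : R).

Let lin t (t0 : 0 <= t) := CP_semigroup_linear hphi t0.
Let cp t (t0 : 0 <= t) := CP_semigroup_cp hphi t0.
Let unital t (t0 : 0 <= t) := CP_semigroup1 hphi t0.

Definition diffquot t A : bop H := (t^-1)%:C *: (phi t A - A).
Definition lip_orbit A : Prop := exists2 M, 0 <= M &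
  \forall t \near 0^'+, bounded_by (M * t%:C) (phi t A - A).
Lemma semigroupD s t A : 0 <= s -> 0 <= t -> phi s (phi t A) = phi (s + t) A.
Proof. by move=> s0 t0; rewrite -(CP_semigroupD hphi s0 t0). Qed.

(** By the Schwarz inequality, |phi_s T x - T x|^2 is at most
      <phi_s (adj T * T) x, x> - 2 Re <phi_s T x, T x> + |T x|^2,
    which is weakly continuous in s and vanishes at s = 0. *)
Lemma strong_continuity T x e : 0 < e ->
  exists2 d : R, 0 < d & forall s, 0 <= s < d -> `|phi s T x - T x| <= e.
Proof.
move=> e0.
have cg A y : {within `[0, +oo[, continuous (fun t => '[phi t A x, y])}.
  exact: (CP_semigroup_continuous hphi).
have e3 : 0 < e ^+ 2 / 3 by rewrite divr_gt0 // exprn_gt0.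
have [r1 r10 h1] := within_ge0_dist_le (cg (adj T * T) x) (lexx 0) e3.
have [r2 r20 h2] := within_ge0_dist_le (cg T (T x)) (lexx 0) e3.
exists (Num.min r1 r2); first by rewrite lt_min r10.
move=> s /andP[s0]; rewrite lt_min => /andP[s1 s2].
have {}h1 := h1 s s0; have {}h2 := h2 s s0.
rewrite sub0r normrN ger0_norm // in h1 h2.
have {}h1 := h1 s1; have {}h2 := h2 s2.
have phi00 : phi 0 = id by exact: CP_semigroup0.
rewrite phi00 /= -adjEr in h1; rewrite phi00 /= in h2.
rewrite -ler_sqr ?nnegrE ?(ltW e0) // -hdot_norm.
have hv := cp_var_ge0 (cp s0) (unital s0) T x.
set n := '[T x, T x] in h1 h2 *.
have nJ : Num.conj n = n by rewrite hdotJ.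
pose X := (n - '[phi s T x, T x]) + Num.conj (n - '[phi s T x, T x]) -
  (n - '[phi s (adj T * T) x, x]).
have distX : '[phi s T x - T x, phi s T x - T x] <= X.
  rewrite -subr_ge0; apply: le_trans hv _; apply: le_of_eq.
  rewrite /cp_var /X rmorphB /= nJ hdotJ !(hdotBl, hdotBr) -/n; ring.
have X0 : 0 <= X by rewrite (le_trans _ distX) // hdot_norm exprn_ge0.
apply: le_trans distX _.
rewrite -(ger0_norm X0) (_ : e ^+ 2 = e ^+ 2 / 3 + e ^+ 2 / 3 + e ^+ 2 / 3).
  rewrite (le_trans (ler_normB _ _)) // lerD //.
  by rewrite (le_trans (ler_normD _ _)) // lerD // norm_conjC.
by field.
Qed.

Lemma diffquot_adj t A : 0 < t -> adj (diffquot t A) = diffquot t (adj A).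
Proof.
move=> /ltW t0; rewrite /diffquot bop_adjZ bop_adjB.
rewrite -(cp_adj (cp t0)); congr (_ *: _).
by rewrite geC0_conj // lecR invr_ge0.
Qed.

Lemma lip_orbit_adj A : lip_orbit A -> lip_orbit (adj A).
Proof.
move=> [M M0 AM]; exists M => //.
apply: filterS2 AM (nbhs_right_gt 0) => t AM t0.
rewrite (cp_adj (cp (ltW t0))) -bop_adjB.
by apply: adj_bound => //; rewrite mulr_ge0 // lecR ltW.
Qed.

Lemma diffquot_bounded A M t : 0 < t -> bounded_by (M * t%:C) (phi t A - A) ->
  bounded_by M (diffquot t A).
Proof.
move=> t0 AM x; have tC0 : 0 < t%:C :> R[i] by rewrite ltcR.
have -> : diffquot t A x = (t%:C)^-1 *: (phi t A - A) x.
  by rewrite /diffquot fmorphV.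
rewrite normrZ gtr0_norm ?invr_gt0 // ler_pdivrMl //.
by rewrite mulrA (mulrC _ M).
Qed.

Lemma semigroup_diffquot s t A : 0 <= s -> 0 <= t ->
  phi s (diffquot t A) = (t^-1)%:C *: (phi (s + t) A - phi s A).
Proof.
move=> s0 t0; rewrite /diffquot (opmapZ (lin s0)) (opmapB (lin s0)).
by rewrite semigroupD.
Qed.

(** A weak limit T of the bounded difference quotients exists along any
    ultrafilter; since the convergence is ultraweak, normality of phi_s carries
    it to phi_s. *)
Lemma weak_derivative A : lip_orbit A ->
  exists (U : set_system R) (T : bop H),
    [/\ UltraFilter U, 0^'+ `<=` U &
    forall s x y, 0 <= s ->
      '[phi s (diffquot t A) x, y] @[t --> U] --> '[phi s T x, y]].
Proof.
move=> [M M0 AM].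
have [U [UU sU]] := ultraFilterLemma (at_right_proper_filter (0 : R)).
have bnd : \forall t \near U, bounded_by M (diffquot t A).
  apply: sU; apply: filterS2 AM (nbhs_right_gt 0) => t AM t0.
  exact: diffquot_bounded.
have bndxy x y : \forall t \near U, `|'[diffquot t A x, y]| <= M * `|x| * `|y|.
  apply: filterS bnd => t tM; apply: le_trans (cauchy_schwarz _ _) _.
  by rewrite ler_wpM2r.
have /choice[B BE] : forall xy : H * H, exists l : R[i],
    '[diffquot t A xy.1, xy.2] @[t --> U] --> l.
  by move=> [x y]; apply/cvg_ex; exact: ultra_bounded_cvg (bndxy x y).
have Blim x y : '[diffquot t A x, y] @[t --> U] --> B (x, y).
  exact: (BE (x, y)).
have lim_unique (f : R -> R[i]) (k l : R[i]) :
    f @ U --> k -> f @ U --> l -> k = l.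
  by move=> fk fl; exact: (norm_cvg_unique fk fl).
have cvg_comb (f g : R -> R[i]) c (k l : R[i]) : f @ U --> k -> g @ U --> l ->
    c * f t + g t @[t --> U] --> c * k + l.
  move=> fk gl; apply: cvgD; last exact: gl.
  by apply: cvgM; [exact: cvg_cst|exact: fk].
have [|||T TE] := @bop_of_form _ _ (fun x y => B (x, y)) M M0.
- move=> c x y z; apply: lim_unique (Blim _ _) _.
  under eq_cvg do rewrite bopD bopZ hdotDl hdotZl.
  exact: cvg_comb.
- move=> c x y z; apply: lim_unique (Blim _ _) _.
  under eq_cvg do rewrite hdotDr hdotZr.
  exact: cvg_comb.
- by move=> x y; apply: limit_norm_le (Blim x y) (bndxy x y).
exists U, T; split=> // s x y s0.
have weak : forall x y,
    '[X x, y] @[X --> diffquot t A @[t --> U]] --> '[T x, y].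
  by move=> u v; rewrite TE; exact: Blim.
have pU : ProperFilter (diffquot t A @[t --> U]) by exact: fmap_proper_filter.
have uw := ultraweak_of_bounded_weak pU M0 bnd weak.
exact: weak_of_ultraweak (CP_semigroup_normal hphi s0 pU uw) x y.
Qed.

(** For s small, compare F r = <phi_r A x, y> - r <T x, y> at s and 0.  Its
    derivative at r along the ultrafilter is <phi_r T x - T x, y>, at most
    e |y| by strong continuity, so [dini_le] bounds the increment of F by
    s e |y|, uniformly in y.  Choosing for y the vector
    phi_s A x - A x - s T x makes this increment equal to |y|^2. *)
Lemma lip_orbit_derivable A : lip_orbit A ->
  exists T : bop H, forall x, diffquot t A x @[t --> 0^'+] --> T x.
Proof.
move=> lipA; have [U [T [UU sU UT]]] := weak_derivative lipA.
exists T => x; apply/cvgrPdist_le => e e0.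
have [d d0 Td] := strong_continuity T x e0.
apply: filterS2 (nbhs_right_gt 0) (nbhs_right_lt d0) => s s0 sd.
pose y := phi s A x - A x - s%:C *: T x.
pose F r := '[phi r A x, y] - r%:C * '[T x, y].
have phi00 : phi 0 = id by exact: CP_semigroup0.
have Fy : F s - F 0 = `|y| ^+ 2.
  rewrite -hdot_norm -[X in '[X, y]]/(phi s A x - A x - s%:C *: T x) /F.
  rewrite phi00 rmorph0 mul0r subr0 !hdotBl hdotZl /=; ring.
have cF : {within `[0, +oo[, continuous F}.
  move=> r; apply: cvgB; first exact: (CP_semigroup_continuous hphi).
  have cr : continuous (fun r : R => r%:C * '[T x, y]).
    move=> q; apply: cvgM; last exact: cvg_cst.
    by apply: cvg_real_complex; exact: cvg_id.
  exact: (continuous_subspaceT cr).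
have dini eta : 0 < eta -> `|F s - F 0| <= (e * `|y| + eta) * s%:C.
  move=> eta0; apply: dini_le => //; first exact: ltW.
    by apply: addr_ge0; [apply: mulr_ge0 => //|]; exact: ltW.
  move=> r /andP[r0 rs] tau tau0.
  have /cvgrPdist_le/(_ _ eta0) nr := UT r x y r0.
  have ntau : \forall t \near U, 0 < t < tau.
    apply: sU; apply: filterS2 (nbhs_right_gt 0) (nbhs_right_lt tau0).
    by move=> t -> ->.
  have [t [/andP[t0 tt] nt]] := filter_ex (filterI ntau nr).
  exists t; first by rewrite t0.
  have tC0 : 0 < t%:C :> R[i] by rewrite ltcR.
  have -> : F (r + t) - F r = t%:C * (('[phi r (diffquot t A) x, y] -
     '[phi r T x, y]) + '[phi r T x - T x, y]).
    rewrite semigroup_diffquot ?(ltW t0) // bop_scaleE bop_subE hdotZl.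
    rewrite !hdotBl /F fmorphV rmorphD /=; field; exact: lt0r_neq0.
  rewrite normrM gtr0_norm // mulrC; apply: ler_wpM2r; first exact: ltW.
  rewrite [leRHS]addrC (le_trans (ler_normD _ _)) // lerD //.
    by rewrite distrC.
  rewrite (le_trans (cauchy_schwarz _ _)) // ler_wpM2r // Td // r0 /=.
  exact: lt_trans sd.
have sC0 : 0 < s%:C :> R[i] by rewrite ltcR.
have ysq : `|y| ^+ 2 <= e * `|y| * s%:C.
  apply/ler_addgt0Pr => eta eta0.
  have := dini (eta / s%:C) (divr_gt0 eta0 sC0).
  by rewrite Fy normrX normr_id mulrDl divfK // lt0r_neq0.
have yes : `|y| <= e * s%:C.
  have [->|y0] := eqVneq y 0; first by rewrite normr0 mulr_ge0 // ltW.
  by rewrite -normr_gt0 in y0; rewrite -(ler_pM2r y0) -expr2 mulrAC.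
have -> : T x - diffquot s A x = - ((s%:C)^-1 *: y).
  have -> : diffquot s A x = (s%:C)^-1 *: (phi s A x - A x).
    by rewrite /diffquot fmorphV.
  rewrite /y [in RHS]scalerBr scalerA mulVf ?scale1r ?opprB //.
  exact: lt0r_neq0.
rewrite normrN normrZ gtr0_norm ?invr_gt0 // ler_pdivrMl // mulrC.
exact: yes.
Qed.

(** The adjoints of the difference quotients are those of adj A, whose limit
    is the adjoint of the limit for A by uniqueness of weak limits. *)
Lemma generator_domain_of_lip_orbit A : lip_orbit A -> generator_domain phi A.
Proof.
move=> lipA; have [T TA] := lip_orbit_derivable lipA.
have [T' T'A] := lip_orbit_derivable (lip_orbit_adj lipA).
have TT' : adj T = T'.
  apply: adj_unique => x y.
  have lim1 : '[diffquot t A x, y] @[t --> 0^'+] --> '[T x, y].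
    exact: hdotl_cvg (TA x).
  have lim2 : '[diffquot t A x, y] @[t --> 0^'+] --> '[x, T' y].
    apply: cvg_trans (hdotr_cvg (y := x) (T'A y)).
    apply: near_eq_cvg; apply: filterS (nbhs_right_gt 0) => t t0.
    by rewrite adjE diffquot_adj.
  exact: (norm_cvg_unique lim1 lim2).
exists T; split=> x; first exact: TA.
suff : adj (diffquot t A) x @[t --> 0^'+] --> T' x by rewrite TT'.
apply: cvg_trans (T'A x).
apply: near_eq_cvg; apply: filterS (nbhs_right_gt 0) => t t0.
by rewrite -diffquot_adj.
Qed.

(** Otherwise there are times t n decreasing to 0 whose difference quotients
    are not bounded by n.  They converge pointwise, which contradicts the
    uniform boundedness principle. *)
Lemma lip_orbit_of_generator_domain A : generator_domain phi A -> lip_orbit A.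
Proof.
move=> [L [AL _]]; apply: contrapT => nlip.
have slopeL x : diffquot t A x @[t --> 0^'+] --> L x by exact: (AL x).
have bad n : exists t : R,
    0 < t < n.+1%:R^-1 /\ ~ bounded_by n%:R (diffquot t A).
  apply: contrapT => noT; apply: nlip; exists n%:R => //.
  have n0 : 0 < n.+1%:R^-1 :> R by rewrite invr_gt0 ltr0n.
  apply: filterS2 (nbhs_right_gt 0) (nbhs_right_lt n0) => t t0 tn.
  apply: contrapT => nb; apply: noT; exists t; split; first by rewrite t0.
  move=> sb; apply: nb => x.
  have tC0 : 0 < t%:C :> R[i] by rewrite ltcR.
  have -> : (phi t A - A) x = t%:C *: diffquot t A x.
    rewrite bop_scaleE scalerA fmorphV mulfV ?scale1r //.
    exact: lt0r_neq0.
  by rewrite normrZ gtr0_norm // mulrAC mulrC ler_pM2r.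
have [t tP] := choice bad.
have t0 : t n @[n --> \oo] --> 0^'+.
  move=> P [r /= r0 Pr].
  have [N _ Nr] := near_infty_natSinv_lt (PosNum r0).
  exists N => // n /= Nn; have [/andP[tn0 tn] _] := tP n.
  apply: (Pr (t n)) => //=.
  rewrite sub0r normrN gtr0_norm //.
  exact: lt_trans tn (Nr n Nn).
have [|M M0 TM] := @uniform_boundedness R H (fun n => diffquot (t n) A).
  move=> x.
  have /cvg_seq_bounded/pinfty_ex_gt0 [M M0 sM] :
      cvgn (fun n => diffquot (t n) A x).
    by apply/cvg_ex; exists (L x); exact: cvg_comp t0 (slopeL x).
  by exists M => n; exact: sM.
have [N NM] : exists N : nat, M <= N%:R.
  have [|N] := @ex_inv_succ_lt R (M + 1)^-1; first by rewrite invr_gt0 ltr_wpDl.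
  rewrite ltf_pV2 ?posrE ?ltr0n // => [h|]; last by rewrite ltr_wpDl.
  exists N.+1; apply: le_trans (ltW h); by rewrite lerDl.
case: (tP N) => _; apply=> x; apply: le_trans (TM N x) _.
by rewrite ler_wpM2r.
Qed.

Lemma generator_domainE A : generator_domain phi A <-> lip_orbit A.
Proof.
split; first exact: lip_orbit_of_generator_domain.
exact: generator_domain_of_lip_orbit.
Qed.

End Generator.

(** * The domain algebra *)

Section DomainAlgebra.
Context {R : realType} {H : hilbertType R}.
Variable phi : R -> bop H -> bop H.
Hypothesis hphi : CP_semigroup phi.
Implicit Types (x : H) (c K M : R[i]) (A B : bop H) (s t : R).

Let lin t (t0 : 0 < t) := CP_semigroup_linear hphi (ltW t0).
Let cp t (t0 : 0 < t) := CP_semigroup_cp hphi (ltW t0).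
Let unital t (t0 : 0 < t) := CP_semigroup1 hphi (ltW t0).
Let realC_ge0 t : 0 < t -> 0 <= t%:C :> R[i].
Proof. by move=> t0; rewrite lecR ltW. Qed.

Definition linear_var A : Prop := exists2 K, 0 <= K &
  \forall t \near 0^'+, forall x, cp_var (phi t) A x <= K * t%:C * `|x| ^+ 2.

Lemma lip_orbit0 : lip_orbit phi 0.
Proof.
exists 0 => //; apply: filterS (nbhs_right_gt 0) => t t0 x.
by rewrite (opmap0 (lin t0)) subrr bop_zeroE normr0 !mul0r.
Qed.

Lemma lip_orbit_comb c A B :
  lip_orbit phi A -> lip_orbit phi B -> lip_orbit phi (c *: A + B).
Proof.
move=> [M M0 AM] [N N0 BN]; exists (`|c| * M + N).
  by rewrite addr_ge0 // mulr_ge0.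
apply: filterS3 (nbhs_right_gt 0) AM BN => t t0 AM BN x.
rewrite (lin t0) opprD addrACA -scalerBr bop_addE bop_scaleE.
rewrite (le_trans (ler_normD _ _)) // normrZ !mulrDl lerD //.
by rewrite -!mulrA ler_wpM2l // mulrA.
Qed.

Lemma lip_orbitD A B :
  lip_orbit phi A -> lip_orbit phi B -> lip_orbit phi (A + B).
Proof. by move=> lA lB; rewrite -[A]scale1r; exact: lip_orbit_comb. Qed.

Lemma lip_orbitZ c A : lip_orbit phi A -> lip_orbit phi (c *: A).
Proof.
move=> lA; rewrite -[_ *: _]addr0.
by apply: lip_orbit_comb => //; exact: lip_orbit0.
Qed.

Lemma lip_orbitB A B :
  lip_orbit phi A -> lip_orbit phi B -> lip_orbit phi (A - B).
Proof.
move=> lA lB; rewrite -scaleN1r.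
by apply: lip_orbitD => //; exact: lip_orbitZ.
Qed.

Lemma linear_var0 : linear_var 0.
Proof.
exists 0 => //; apply: filterS (nbhs_right_gt 0) => t t0 x.
rewrite /cp_var mulr0 (opmap0 (lin t0)) bop_zeroE !hdot0l subrr.
by rewrite !mul0r.
Qed.

Lemma linear_var_comb c A B :
  linear_var A -> linear_var B -> linear_var (c *: A + B).
Proof.
move=> [M M0 AM] [N N0 BN]; exists (2 * (`|c| ^+ 2 * M) + 2 * N).
  by rewrite addr_ge0 // !mulr_ge0.
apply: filterS3 (nbhs_right_gt 0) AM BN => t t0 AM BN x.
apply: le_trans (cp_varD (lin t0) (cp t0) (unital t0) _ _ _) _.
rewrite (cp_varZ (lin t0)).
have -> : (2 * (`|c| ^+ 2 * M) + 2 * N) * t%:C * `|x| ^+ 2 =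
  2 * (`|c| ^+ 2 * (M * t%:C * `|x| ^+ 2)) + 2 * (N * t%:C * `|x| ^+ 2) by ring.
by apply: lerD; rewrite ler_wpM2l // ler_wpM2l // exprn_ge0.
Qed.

Lemma linear_varM A B : linear_var A -> linear_var B -> linear_var (A * B).
Proof.
move=> [M M0 AM] [N N0 BN].
have [a a0 Aa] := bop_bounded A; have [b b0 Bb] := bop_bounded B.
exists (2 * a ^+ 2 * N + 2 * (M * b ^+ 2)).
  by rewrite addr_ge0 // !mulr_ge0.
apply: filterS3 (nbhs_right_gt 0) AM BN => t t0 AM BN x.
apply: le_trans (cp_varM (lin t0) (cp t0) (unital t0) _ _ a0 Aa) _.
have -> : (2 * a ^+ 2 * N + 2 * (M * b ^+ 2)) * t%:C * `|x| ^+ 2 =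
    2 * a ^+ 2 * (N * t%:C * `|x| ^+ 2) + 2 * (M * t%:C * (b * `|x|) ^+ 2).
  by ring.
apply: lerD; first by rewrite ler_wpM2l // mulr_ge0 // exprn_ge0.
rewrite ler_wpM2l // (le_trans (AM _)) // ler_wpM2l ?mulr_ge0 ?realC_ge0 //.
rewrite ler_sqr ?nnegrE ?mulr_ge0 //.
exact: (cp_contractive (lin t0) (cp t0) (unital t0) b0 Bb).
Qed.

(** The two forms differ by |phi_t A x|^2 - |A x|^2, a product of a factor
    O(t) and a bounded one. *)
Lemma cp_var_drift A : lip_orbit phi A -> exists2 K, 0 <= K &
  \forall t \near 0^'+, forall x,
    `|'[(phi t (adj A * A) - adj A * A) x, x] - cp_var (phi t) A x|
      <= K * t%:C * `|x| ^+ 2.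
Proof.
move=> [M M0 AM]; have [a a0 Aa] := bop_bounded A.
exists (2 * (M * a)); first by rewrite !mulr_ge0.
apply: filterS2 (nbhs_right_gt 0) AM => t t0 AM x.
have pa := cp_contractive (lin t0) (cp t0) (unital t0) a0 Aa.
have {AM}dA : `|phi t A x - A x| <= M * t%:C * `|x| by exact: AM.
have -> : '[(phi t (adj A * A) - adj A * A) x, x] - cp_var (phi t) A x =
    '[phi t A x - A x, phi t A x] + '[A x, phi t A x - A x].
  rewrite /cp_var bop_subE bop_mulE !hdotBl !hdotBr -[X in - X]adjEr; ring.
rewrite (le_trans (ler_normD _ _)) //.
have -> : 2 * (M * a) * t%:C * `|x| ^+ 2 =
  (M * t%:C * `|x|) * (a * `|x|) + (a * `|x|) * (M * t%:C * `|x|) by ring.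
by rewrite lerD // (le_trans (cauchy_schwarz _ _)) // ler_pM.
Qed.

Lemma lip_orbit_square A :
  lip_orbit phi A -> linear_var A -> lip_orbit phi (adj A * A).
Proof.
move=> lipA [N N0 AN]; have [K K0 AK] := cp_var_drift lipA.
exists (2 * (K + N)); first by rewrite mulr_ge0 // addr_ge0.
apply: filterS3 (nbhs_right_gt 0) AN AK => t t0 AN AK.
rewrite -mulrA; apply: bounded_by_quadratic_form => [|x].
  by rewrite mulr_ge0 ?addr_ge0 ?realC_ge0.
rewrite -(subrK (cp_var (phi t) A x) '[_, _]) (le_trans (ler_normD _ _)) //.
have -> : (K + N) * t%:C * `|x| ^+ 2 =
  K * t%:C * `|x| ^+ 2 + N * t%:C * `|x| ^+ 2 by ring.
rewrite lerD // ger0_norm //.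
exact: cp_var_ge0 (cp t0) (unital t0) _ _.
Qed.

Lemma linear_var_of_square A :
  lip_orbit phi A -> lip_orbit phi (adj A * A) -> linear_var A.
Proof.
move=> lipA [N N0 AN]; have [K K0 AK] := cp_var_drift lipA.
exists (N + K); first by rewrite addr_ge0.
apply: filterS3 (nbhs_right_gt 0) AN AK => t t0 AN AK x.
rewrite -[leLHS]ger0_norm; last exact: cp_var_ge0 (cp t0) (unital t0) _ _.
have {AK} := AK x; set q := '[(phi t (adj A * A) - adj A * A) x, x] => AK.
have -> : cp_var (phi t) A x = q - (q - cp_var (phi t) A x) by ring.
have -> : (N + K) * t%:C * `|x| ^+ 2 =
  N * t%:C * `|x| ^+ 2 + K * t%:C * `|x| ^+ 2 by ring.
rewrite (le_trans (ler_normB _ _)) // lerD //.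
rewrite (le_trans (cauchy_schwarz _ _)) // expr2 mulrA ler_wpM2r //.
Qed.

(** For |c| = 1, subtracting the two diagonal terms from
    adj (c B + A) * (c B + A) leaves c (adj A * B) + conj c (adj B * A); the
    values c = 1 and c = i separate the two products. *)
Lemma lip_orbit_adj_mul A B :
    lip_orbit phi A -> linear_var A -> lip_orbit phi B -> linear_var B ->
  lip_orbit phi (adj A * B).
Proof.
move=> lA vA lB vB.
have sq c : lip_orbit phi (adj (c *: B + A) * (c *: B + A)).
  by apply: lip_orbit_square; [exact: lip_orbit_comb|exact: linear_var_comb].
have lAA := lip_orbit_square lA vA; have lBB := lip_orbit_square lB vB.
pose P c := adj (c *: B + A) * (c *: B + A) - adj A * A - adj B * B.
have lP c : lip_orbit phi (P c).
  by apply: lip_orbitB => //; apply: lip_orbitB.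
have PE c : `|c| = 1 ->
    P c = c *: (adj A * B) + Num.conj c *: (adj B * A).
  move=> c1; rewrite /P bop_adjD bop_adjZ mulrDl !mulrDr.
  rewrite !bop_scaleAl !bop_scaleAr scalerA mulrC -normCK c1 expr1n scale1r.
  by rewrite !addrA addrK -!addrA addrC -!addrA addNr addr0 addrC.
have -> : adj A * B = 2^-1 *: (P 1 - 'i *: P 'i).
  rewrite !PE ?normr1 ?normCi // conjC1 conjCi !scale1r.
  rewrite [X in _ - X]scalerDr !scalerA mulrN -expr2 sqrCi opprK.
  rewrite scaleN1r scale1r opprD opprK addrACA subrr addr0.
  by rewrite scalerDr -scalerDl -[2^-1]mul1r -splitr scale1r.
by apply: lip_orbitZ; apply: lip_orbitB => //; exact: lip_orbitZ.
Qed.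

Lemma domain_algebraE A :
  domain_algebra phi A <->
    [/\ lip_orbit phi A, linear_var A & linear_var (adj A)].
Proof.
rewrite /domain_algebra /= !(generator_domainE hphi); split.
  move=> [lA [lAA lA'A]]; have lA' := lip_orbit_adj hphi lA.
  split=> //; first exact: linear_var_of_square.
  by apply: linear_var_of_square => //; rewrite bop_adjK.
move=> [lA vA vA']; split=> //; split; first exact: lip_orbit_square.
by rewrite -{1}[A]bop_adjK; apply: lip_orbit_square => //; exact: lip_orbit_adj.
Qed.

End DomainAlgebra.

Theorem theoremA (R : realType) (H : hilbertType R) (sepH : separable H)
    (phi : R -> bop H -> bop H) (hphi : CP_semigroup phi) :
  star_subalgebra (domain_algebra phi).
Proof.
split.
- split=> [|c A B]; rewrite !inE.
    apply/(domain_algebraE hphi).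
    have -> : adj (0 : bop H) = 0.
      by apply: adj_unique => x y; rewrite !bop_zeroE hdot0l hdot0r.
    by split; [exact: lip_orbit0|exact: linear_var0|exact: linear_var0].
  move=> /(domain_algebraE hphi)[lA vA vA'] /(domain_algebraE hphi)[lB vB vB'].
  apply/(domain_algebraE hphi); rewrite bop_adjD bop_adjZ.
  by split; [exact: lip_orbit_comb|exact: linear_var_comb..].
- move=> A B; rewrite !inE.
  move=> /(domain_algebraE hphi)[lA vA vA'] /(domain_algebraE hphi)[lB vB vB'].
  apply/(domain_algebraE hphi); rewrite bop_adjM.
  split; [|exact: linear_varM|exact: linear_varM].
  by rewrite -[A]bop_adjK; apply: lip_orbit_adj_mul => //; exact: lip_orbit_adj.
- move=> A /(domain_algebraE hphi)[lA vA vA'].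
  apply/(domain_algebraE hphi); rewrite bop_adjK; split=> //.
  exact: lip_orbit_adj.
Qed.
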